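(* Let $(V,g)$ be an inner product vector space over $k$, with $k=\mathbb{R}$ or $k=\mathbb{C}$ (possibly infinite-dimensional), and let $\varphi\in\operatorname{End}_k(V)$ be a finite potent endomorphism. If a core inverse $\varphi^{(\#)}$ of $\varphi$ exists, then $\varphi^{(\#)}$ is a finite potent endomorphism with $i(\varphi^{(\#)})\leq 1$. Moreover, the core inverse $\varphi^{(\#)}$ is unique.
   Context: An endomorphism $\varphi$ of $V$ is finite potent if $\varphi^n(V)$ is finite-dimensional for some $n$. Equivalently, there is a (unique) $\varphi$-invariant decomposition $V=W_\varphi\oplus U_\varphi$ (AST-decomposition) with $\varphi|_{U_\varphi}$ nilpotent, $W_\varphi$ finite-dimensional and $\varphi|_{W_\varphi}$ an automorphism of $W_\varphi$. The index $i(\varphi)$ is the nilpotency order of $\varphi|_{U_\varphi}$ (with $i(\varphi)=0$ iff $V$ is finite-dimensional and $\varphi$ is an automorphism). A linear map $\varphi^{(\#)}\in\operatorname{End}_k(V)$ is a core inverse of $\varphi$ when $V=\operatorname{Im}(\varphi)\oplus[\operatorname{Im}(\varphi)]^{\perp}$, $\varphi\circ\varphi^{(\#)}=P_{\operatorname{Im}(\varphi)}$ and $\operatorname{Im}(\varphi^{(\#)})\subseteq\operatorname{Im}(\varphi)$, where $P_{\operatorname{Im}(\varphi)}$ is the orthogonal projection onto $\operatorname{Im}(\varphi)$ induced by that decomposition. *)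

(* Defs.v *)
From mathcomp Require Import all_boot all_order all_algebra.
From mathcomp Require Import mathcomp_extra boolp classical_sets functions.
From mathcomp Require Import reals.
From mathcomp.real_closed Require Import complex.

Set Implicit Arguments.
Unset Strict Implicit.
Unset Printing Implicit Defensive.

Import Order.TTheory GRing.Theory Num.Theory.

Local Open Scope classical_set_scope.
Local Open Scope ring_scope.

(* Vector spaces are arbitrary left modules over a field, of any dimension;
   their subspaces are sets of vectors. *)
Section FinitePotent.
Context {K : fieldType} {V : lmodType K}.
Implicit Types (S T W U : set V) (phi psi : V -> V) (n i : nat).

Definition subspace S : Prop :=
  S 0 /\ forall (a : K) (u v : V), S u -> S v -> S (a *: u + v).

Definition direct_sum S T : Prop :=
  [/\ subspace S, subspace T, S `&` T = [set 0] &
      forall v : V, exists s t : V, [/\ S s, T t & v = s + t]].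

Definition finite_dimensional S : Prop :=
  exists (n : nat) (e : 'I_n -> V),
    S = [set v | exists c : 'I_n -> K, v = \sum_(j < n) c j *: e j].

Definition finite_potent phi : Prop :=
  exists n, finite_dimensional (range (iter n phi)).

Definition vanishes_on phi U n : Prop :=
  forall u, U u -> iter n phi u = 0.

Definition nilpotent_on phi U : Prop := exists n, vanishes_on phi U n.

Definition nilpotency_order phi U n : Prop :=
  vanishes_on phi U n /\ forall m, vanishes_on phi U m -> (n <= m)%N.

Definition AST_decomposition phi W U : Prop :=
  [/\ direct_sum W U, set_fun W W phi /\ set_fun U U phi, nilpotent_on phi U,
      finite_dimensional W & set_bij W W phi].

(* [has_index phi i] reads i(phi) = i. The order on U = 0 is 0, as iter 0 is
   the identity, so i(phi) = 0 means that phi is an automorphism of V = W. *)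
Definition has_index phi i : Prop :=
  exists W U, AST_decomposition phi W U /\ nilpotency_order phi U i.

Lemma iter_surj_on phi W n : set_surj W W phi ->
  forall w, W w -> exists2 w', W w' & iter n phi w' = w.
Proof.
move=> sW; elim: n => [|n IHn] w Ww; first by exists w.
have [x Wx <-] := sW _ Ww.
by have [y Wy <-] := IHn _ Wx; exists y.
Qed.

Lemma iter_on phi W n : set_fun W W phi -> forall w, W w -> W (iter n phi w).
Proof. by move=> fW w Ww; elim: n => //= n; apply: fW. Qed.

Lemma iter_linD (phi : {linear V -> V}) n (u v : V) :
  iter n phi (u + v) = iter n phi u + iter n phi v.
Proof. by elim: n => //= n ->; rewrite linearD. Qed.

Lemma AST_decomposition_sub (phi : {linear V -> V}) W U W' U' :
  AST_decomposition phi W U -> AST_decomposition phi W' U' ->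
  W `<=` W' /\ U `<=` U'.
Proof.
move=> [[sW _ _ _] [fW _] [n Un] _ [_ _ sjW]].
move=> [[sW' sU' WU' dec'] [fW' fU'] [m U'm] _ [_ inj' _]]; split.
  move=> w Ww; have [x Wx <-] := iter_surj_on m sjW Ww.
  have [s [t [W's U't ->]]] := dec' x.
  by rewrite iter_linD (U'm _ U't) addr0; apply: iter_on.
move=> u Uu; have [s [t [W's U't uE]]] := dec' u.
have phi0 k : iter k phi 0 = 0 by elim: k => //= k ->; rewrite linear0.
suff s0 : s = 0 by rewrite uE s0 add0r.
have it0 k s' : W' s' -> iter k phi s' = 0 -> s' = 0.
  elim: k s' => //= k IHk s' Ws' e; apply: IHk => //.
  apply: inj'; rewrite ?inE ?linear0 //; first exact: iter_on.
  by case: sW'.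
apply: (it0 (n + m)%N) => //.
have : iter (n + m) phi u = 0 by rewrite addnC iterD (Un _ Uu) phi0.
by rewrite uE iter_linD [X in _ + X]iterD (U'm _ U't) phi0 addr0.
Qed.

Lemma has_index_unique (phi : {linear V -> V}) i j :
  has_index phi i -> has_index phi j -> i = j.
Proof.
move=> [W [U [d [Ui mini]]]] [W' [U' [d' [U'j minj]]]].
have [_ UU'] := AST_decomposition_sub d d'.
have [_ U'U] := AST_decomposition_sub d' d.
apply/eqP; rewrite eqn_leq; apply/andP; split.
  by apply: mini => u /UU'; apply: U'j.
by apply: minj => u /U'U; apply: Ui.
Qed.

End FinitePotent.

Section CoreInverse.
Context {K : fieldType} {V : lmodType K}.
Variable g : V -> V -> K.
Implicit Types (S T : set V) (P phi psi : V -> V).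

Definition orthogonal_complement S : set V :=
  [set v | forall s, S s -> g s v = 0].

Definition projection_along S T P : Prop :=
  forall s t, S s -> T t -> P (s + t) = s.

Definition core_inverse phi psi : Prop :=
  let I := range phi in
  [/\ direct_sum I (orthogonal_complement I),
      projection_along I (orthogonal_complement I) (phi \o psi) &
      range psi `<=` I].

End CoreInverse.

(* Main.v *)
(* phi \o psi fixes the image I of phi and psi maps into I, so phi maps I onto
   itself. Hence I is the image of every positive power of phi, it is finite
   dimensional, and phi is injective on it. So psi is the inverse of phi on I
   and 0 on the complement of I: this determines psi, and (I, complement of I)
   is its AST-decomposition. *)
Require Import Defs.
From mathcomp Require Import all_boot all_order all_algebra.
From mathcomp Require Import boolp classical_sets.
From mathcomp Require Import reals.
From mathcomp.real_closed Require Import complex.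

Import GRing.Theory.

Local Open Scope ring_scope.
Local Open Scope complex_scope.
Local Open Scope classical_set_scope.

Section FiniteDimensional.
Context {K : fieldType} {V : lmodType K}.
Implicit Types (S : set V) (phi : {linear V -> V}).

(** Exposes the length [n] that [finite_dimensional] hides, so that it can be the measure of a
    descent. *)
Definition spanned_by S n (e : 'I_n -> V) : Prop :=
  S = [set v | exists c : 'I_n -> K, v = \sum_(j < n) c j *: e j].

Lemma spanned_by_image S n (e : 'I_n -> V) phi :
  spanned_by S n e -> spanned_by (phi @` S) n (phi \o e).
Proof.
move=> ->; apply/seteqP; split=> v /=.
  move=> [_ [c ->] <-]; exists c; rewrite linear_sum.
  by apply: eq_bigr => j _; rewrite linearZ.
move=> [c ->]; exists (\sum_(j < n) c j *: e j); first by exists c.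
by rewrite linear_sum; apply: eq_bigr => j _; rewrite linearZ.
Qed.

Lemma finite_dimensional_image S phi :
  finite_dimensional S -> finite_dimensional (phi @` S).
Proof. by move=> [n [e Se]]; exists n, (phi \o e); apply: spanned_by_image. Qed.

(* A nonzero kernel vector can replace a member of a spanning family, so that
   the image is spanned by one vector fewer. *)
Lemma spanned_by_image_ker S n (e : 'I_n.+1 -> V) phi u :
  spanned_by S n.+1 e -> S u -> u != 0 -> phi u = 0 ->
  exists e' : 'I_n -> V, spanned_by (phi @` S) n e'.
Proof.
move=> Se; rewrite {1}Se => -[c uE] u0 phiu.
have [i ci0] : exists i, c i != 0.
  apply/existsP; apply: contraNT u0; rewrite negb_exists => /forallP c0.
  rewrite uE big1 // => j _.
  by have /negPn/eqP -> := c0 j; rewrite scale0r.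
exists (fun j => phi (e (lift i j))); rewrite (spanned_by_image _ _ _ _ Se).
apply/seteqP; split=> v /=; last first.
  (* The omitted index [i] receives the default coefficient 0. *)
  move=> [d ->]; exists (fun j => oapp d 0 (unlift i j)).
  rewrite (bigD1_ord i) //= unlift_none /= scale0r add0r.
  by apply: eq_bigr => j _; rewrite liftK.
(* Subtracting [d i / c i] times the relation [phi u = 0] cancels the coefficient at [i]. *)
move=> [d ->]; exists (fun j => d (lift i j) - d i / c i * c (lift i j)).
have phiu0 : \sum_(j < n.+1) c j *: phi (e j) = 0.
  rewrite -[RHS]phiu uE linear_sum; apply: eq_bigr => j _.
  by rewrite linearZ.
transitivity (\sum_(j < n.+1) d j *: phi (e j)
              - (d i / c i) *: \sum_(j < n.+1) c j *: phi (e j)).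
  by rewrite phiu0 scaler0 subr0.
rewrite scaler_sumr -sumrB (bigD1_ord i) //= scalerA divfK // subrr add0r.
by apply: eq_bigr => j _; rewrite scalerA scalerBl.
Qed.

(** Descent: a nonzero kernel vector would let the image of [S], which is [S] again, be spanned by
    one vector fewer, down to the empty family, which spans only 0. *)
Lemma surj_inj_finite_dimensional S phi :
  finite_dimensional S -> phi @` S = S ->
  forall u, S u -> phi u = 0 -> u = 0.
Proof.
move=> [n [e Se]] phiS u Su phiu; apply: contrapT => /eqP u0.
elim: n e Se => [|n IHn] e Se.
  by move: Su u0; rewrite Se => -[c ->]; rewrite big_ord0 eqxx.
have [e' Se'] := spanned_by_image_ker _ _ _ _ _ Se Su u0 phiu.
by apply: (IHn e'); rewrite phiS in Se'.
Qed.

End FiniteDimensional.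

Section CoreInverse.
Context {K : fieldType} {V : lmodType K} (g : V -> V -> K).
Variable phi : {linear V -> V}.
Hypothesis phi_fp : finite_potent phi.
Implicit Type psi : {linear V -> V}.

Lemma core_inverse_projK psi : core_inverse g phi psi ->
  forall s, range phi s -> phi (psi s) = s.
Proof.
move=> [[_ [T0 _] _ _] proj _] s Is.
by have := proj _ _ Is T0; rewrite addr0.
Qed.

Lemma core_inverse_proj0 psi : core_inverse g phi psi ->
  forall t, orthogonal_complement g (range phi) t -> phi (psi t) = 0.
Proof.
move=> [[[I0 _] _ _ _] proj _] t Tt.
by have := proj _ _ I0 Tt; rewrite add0r.
Qed.

Lemma core_inverse_range psi : core_inverse g phi psi ->
  forall v, range phi (psi v).
Proof. by move=> [_ _ sub] v; apply: sub; exists v. Qed.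

Lemma core_inverse_surj psi : core_inverse g phi psi ->
  phi @` range phi = range phi.
Proof.
move=> cpsi; apply/seteqP; split=> v; first by move=> [w _ <-]; exists w.
move=> Iv; exists (psi v); first exact: core_inverse_range.
exact: core_inverse_projK.
Qed.

Lemma core_inverse_range_fd psi : core_inverse g phi psi ->
  finite_dimensional (range phi).
Proof.
move=> cpsi; have [n fdn] := phi_fp.
have rS k : range (iter k.+1 phi) = phi @` range (iter k phi).
  by rewrite image_comp.
(* The power is [n.+1] because [n] may be 0, where the range is all of [V]. *)
suff -> : range phi = range (iter n.+1 phi).
  by rewrite rS; apply: finite_dimensional_image.
by elim: (n) => [//|k IHk]; rewrite rS -IHk (core_inverse_surj _ cpsi).
Qed.

Lemma core_inverse_inj psi : core_inverse g phi psi ->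
  forall u v, range phi u -> range phi v -> phi u = phi v -> u = v.
Proof.
(* Writing both vectors as images puts their difference [phi (u' - v')] in the range, where the
   kernel of [phi] is trivial. *)
move=> cpsi u v [u' _ <-] [v' _ <-] /eqP; rewrite -subr_eq0 -!linearB => /eqP uv.
apply/eqP; rewrite -subr_eq0 -linearB; apply/eqP; move: uv.
apply: (surj_inj_finite_dimensional (range phi)); last by exists (u' - v').
- exact: core_inverse_range_fd cpsi.
- exact: core_inverse_surj cpsi.
Qed.

(** Both sides lie in the range of [phi] and are sent by [phi] to [phi s]; injectivity there
    concludes. *)
Lemma core_inverse_leftK psi : core_inverse g phi psi ->
  forall s, range phi s -> psi (phi s) = s.
Proof.
move=> cpsi s Is; apply: (core_inverse_inj _ cpsi) => //.
  exact: core_inverse_range.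
by apply: core_inverse_projK => //; exists s.
Qed.

Lemma core_inverse_vanish psi : core_inverse g phi psi ->
  forall t, orthogonal_complement g (range phi) t -> psi t = 0.
Proof.
move=> cpsi t Tt; apply: (core_inverse_inj _ cpsi).
- exact: core_inverse_range.
- by exists 0; rewrite ?linear0.
- by rewrite linear0; apply: core_inverse_proj0.
Qed.

Lemma core_inverse_finite_potent psi : core_inverse g phi psi ->
  finite_potent psi.
Proof.
(* One application suffices: [psi] has the same range as [phi], since each [v] in the latter is
   [psi (phi v)]. *)
move=> cpsi; exists 1; have := core_inverse_range_fd _ cpsi.
congr finite_dimensional; apply/seteqP; split=> v.
  by move=> Iv; exists (phi v) => //=; apply: core_inverse_leftK.
by move=> [w _ <-]; apply: core_inverse_range.
Qed.

Lemma core_inverse_AST psi : core_inverse g phi psi ->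
  AST_decomposition psi (range phi) (orthogonal_complement g (range phi)).
Proof.
move=> cpsi; have [dIT _ _] := cpsi; have [_ [T0 _] _ _] := dIT.
split=> //; first split.
- by move=> s _; apply: core_inverse_range.
- by move=> t /(core_inverse_vanish _ cpsi) ->.
- by exists 1; apply: core_inverse_vanish.
- exact: core_inverse_range_fd cpsi.
split.
- by move=> s _; apply: core_inverse_range.
- move=> s t; rewrite !inE => Is It st.
  by rewrite -(core_inverse_projK _ cpsi _ Is) st core_inverse_projK.
- move=> s Is; exists (phi s); first by exists s.
  exact: core_inverse_leftK.
Qed.

Lemma core_inverse_index psi : core_inverse g phi psi ->
  exists2 i : nat, has_index psi i & (i <= 1)%N.
Proof.
move=> cpsi; have AST := core_inverse_AST _ cpsi.
(* As [iter 0] is the identity, order 0 means that the complement is zero; otherwise the order is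
   exactly 1. *)
have [van0|nvan0] :=
    pselect (vanishes_on psi (orthogonal_complement g (range phi)) 0).
  by exists 0%N => //; do 2![eexists]; split; first exact: AST.
exists 1%N => //; do 2![eexists]; split; first exact: AST.
by split; [apply: core_inverse_vanish | case].
Qed.

Lemma core_inverse_unique psi psi' :
  core_inverse g phi psi -> core_inverse g phi psi' -> psi' =1 psi.
Proof.
move=> cpsi cpsi' v; have [[_ _ _ dec] _ _] := cpsi.
have [s [t [Is Tt ->]]] := dec v; rewrite !linearD.
rewrite (core_inverse_vanish _ cpsi _ Tt) (core_inverse_vanish _ cpsi' _ Tt) !addr0.
(* Only the components in the range remain: [psi' s] and [psi s] are both preimages of [s] under
   [phi] in that range. *)
apply: (core_inverse_inj _ cpsi); do 1?exact: core_inverse_range.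
by rewrite !core_inverse_projK.
Qed.

End CoreInverse.

(** Inner products are the positive definite forms that are Hermitian for [idfun] over the reals and
    for conjugation over [R[i]]; both cases are instances of the same lemmas. *)
Theorem corollary4p3 (R : realType) :
  (forall (V : lmodType R) (g : {dot V for idfun}) (phi : {linear V -> V}),
     finite_potent phi ->
     forall psi : {linear V -> V}, core_inverse g phi psi ->
       [/\ finite_potent psi,
           exists2 i : nat, has_index psi i & (i <= 1)%N &
           forall psi' : {linear V -> V}, core_inverse g phi psi' ->
             psi' =1 psi])
  /\
  (forall (V : lmodType R[i]) (g : {dot V for @Num.conj R[i]})
          (phi : {linear V -> V}),
     finite_potent phi ->
     forall psi : {linear V -> V}, core_inverse g phi psi ->
       [/\ finite_potent psi,
           exists2 i : nat, has_index psi i & (i <= 1)%N &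
           forall psi' : {linear V -> V}, core_inverse g phi psi' ->
             psi' =1 psi]).
Proof.
split=> V g phi phi_fp psi cpsi; split.
- exact: core_inverse_finite_potent cpsi.
- exact: core_inverse_index cpsi.
- by move=> psi'; apply: core_inverse_unique cpsi.
- exact: core_inverse_finite_potent cpsi.
- exact: core_inverse_index cpsi.
- by move=> psi'; apply: core_inverse_unique cpsi.
Qed.
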